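(* Let $\boldsymbol{K}\in\mathbb{R}^{N_l\times N}$, $\boldsymbol{r}\in\mathbb{R}^{N_l}$, and let $\boldsymbol{C}\in\mathbb{R}^{k\times N}$ have full row rank $k\le N$. For $\gamma\ge 0$ let $$\boldsymbol{n}_\gamma:=\underset{\boldsymbol{n}\in\mathbb{R}^N}{\mathrm{argmin}}\ \tfrac12\|\boldsymbol{K}\boldsymbol{n}-\boldsymbol{r}\|_2^2+\tfrac12\gamma\|\boldsymbol{n}\|_2^2\quad\text{s.t.}\quad -\boldsymbol{C}\boldsymbol{n}\le 0,$$ and assume $\|\boldsymbol{K}\boldsymbol{n}_\gamma-\boldsymbol{r}\|_2<\|\boldsymbol{r}\|_2$ (equivalently $\boldsymbol{n}_\gamma\ne 0$) for all $\gamma\in[0,\infty)$. Let $\boldsymbol{n}_\infty$ be the minimum norm element, i.e. the minimizer of $\tfrac12\|\boldsymbol{n}\|_2^2$ subject to $-\boldsymbol{C}\boldsymbol{n}\le 0$, and define $r_0:=\|\boldsymbol{K}\boldsymbol{n}_0-\boldsymbol{r}\|_2$ and $r_\infty:=\|\boldsymbol{K}\boldsymbol{n}_\infty-\boldsymbol{r}\|_2$. Then for every $\tau\in[r_0,r_\infty)$ there exists a unique $\gamma\in[0,\infty)$ such that $\|\boldsymbol{K}\boldsymbol{n}_\gamma-\boldsymbol{r}\|_2=\tau$. Moreover, the residual $\|\boldsymbol{K}\boldsymbol{n}_\gamma-\boldsymbol{r}\|_2$ grows strictly monotonically with $\gamma$.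
   Context: Vector inequalities are componentwise and $\|\cdot\|_2$ is the Euclidean norm. For $\gamma>0$ the minimizer is unique; for $\gamma=0$, $\boldsymbol{n}_0$ denotes a fixed minimizer of the problem. *)

(* Defs.v *)
From mathcomp Require Import all_boot all_order all_algebra.
From mathcomp Require Import classical_sets reals.
Set Implicit Arguments.
Unset Strict Implicit.
Unset Printing Implicit Defensive.
Import Order.TTheory GRing.Theory Num.Theory.
Local Open Scope ring_scope.
Local Open Scope classical_set_scope.

(* The norm that MathComp-Analysis puts on matrices is the sup norm. *)
Definition norm2 (R : realType) (m : nat) (x : 'cV[R]_m) : R :=
  Num.sqrt (\sum_(i < m) x i 0 ^+ 2).

Definition vec_le (R : realType) (m : nat) (x y : 'cV[R]_m) : Prop :=
  forall i : 'I_m, x i 0 <= y i 0.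

Definition is_argmin (R : realType) (T : Type) (A : set T) (f : T -> R)
    (x : T) : Prop :=
  A x /\ forall y, A y -> f x <= f y.

Definition feasible (R : realType) (k N : nat) (C : 'M[R]_(k, N)) :
    set 'cV[R]_N :=
  [set x | vec_le (- C *m x) 0].

Definition tikhonov (R : realType) (Nl N : nat) (K : 'M[R]_(Nl, N))
    (r : 'cV[R]_Nl) (gamma : R) (x : 'cV[R]_N) : R :=
  2^-1 * norm2 (K *m x - r) ^+ 2 + 2^-1 * gamma * norm2 x ^+ 2.

(* Main.v *)
(* Write [phi g] for the squared residual of a minimizer with parameter [g].
   Adding the optimality inequalities for two parameters shows that [phi] is
   nondecreasing; since the feasible set is a cone, optimality along the ray
   through a minimizer makes it strictly increasing unless the minimizer is 0.
   Strong convexity yields the Lipschitz bound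
   [phi h - phi g <= 16 |n_0|^2 (h - g)], and [phi g] tends to [|r|^2], which is
   the squared residual of [n_infty = 0]; the intermediate value theorem
   concludes. *)
Require Import Defs.
From mathcomp Require Import all_boot all_order all_algebra.
From mathcomp Require Import classical_sets reals.
From mathcomp Require Import ring lra.
Import Order.TTheory GRing.Theory Num.Theory.
Local Open Scope ring_scope.

(** * Euclidean inner product and norm, and the feasible cone *)

Definition dot {R : realType} {m : nat} (u v : 'cV[R]_m) : R :=
  \sum_(i < m) u i 0 * v i 0.

Lemma dotC {R : realType} {m : nat} (u v : 'cV[R]_m) : dot u v = dot v u.
Proof. by apply: eq_bigr => i _; rewrite mulrC. Qed.

Lemma dotDl {R : realType} {m : nat} (u v w : 'cV[R]_m) :
  dot (u + v) w = dot u w + dot v w.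
Proof. by rewrite -big_split; apply: eq_bigr => i _; rewrite mxE mulrDl. Qed.

Lemma dotZl {R : realType} {m : nat} (a : R) (u v : 'cV[R]_m) :
  dot (a *: u) v = a * dot u v.
Proof. by rewrite mulr_sumr; apply: eq_bigr => i _; rewrite mxE mulrA. Qed.

Lemma dotDr {R : realType} {m : nat} (u v w : 'cV[R]_m) :
  dot u (v + w) = dot u v + dot u w.
Proof. by rewrite !(dotC u) dotDl. Qed.

Lemma dotZr {R : realType} {m : nat} (a : R) (u v : 'cV[R]_m) :
  dot u (a *: v) = a * dot u v.
Proof. by rewrite !(dotC u) dotZl. Qed.

Lemma dot_mulmxl {R : realType} {m p : nat} (A : 'M[R]_(m, p))
    (u : 'cV[R]_p) (v : 'cV[R]_m) : dot (A *m u) v = dot u (A^T *m v).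
Proof.
have dotE q (x y : 'cV[R]_q) : dot x y = (x^T *m y) 0 0.
  by rewrite mxE; apply: eq_bigr => i _; rewrite mxE.
by rewrite !dotE trmx_mul mulmxA.
Qed.

Lemma sqr_norm2 {R : realType} {m : nat} (u : 'cV[R]_m) :
  norm2 u ^+ 2 = dot u u.
Proof.
by rewrite sqr_sqrtr //; apply: sumr_ge0 => i _; exact: sqr_ge0.
Qed.

Lemma norm2_ge0 {R : realType} {m : nat} (u : 'cV[R]_m) : 0 <= norm2 u.
Proof. exact: sqrtr_ge0. Qed.

Lemma sqr_norm2_eq0 {R : realType} {m : nat} (u : 'cV[R]_m) :
  norm2 u ^+ 2 = 0 -> u = 0.
Proof.
rewrite sqr_norm2 => /eqP.
rewrite psumr_eq0 => [/allP u0|i _]; last exact: sqr_ge0.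
apply/colP => i; rewrite mxE; apply/eqP.
by rewrite -sqrf_eq0 expr2; apply: (implyP (u0 i (mem_index_enum i))).
Qed.

Lemma sqr_norm2D {R : realType} {m : nat} (u v : 'cV[R]_m) :
  norm2 (u + v) ^+ 2 = norm2 u ^+ 2 + 2 * dot u v + norm2 v ^+ 2.
Proof. by rewrite !sqr_norm2 dotDl !dotDr (dotC v u); ring. Qed.

Lemma sqr_norm2Z {R : realType} {m : nat} (a : R) (u : 'cV[R]_m) :
  norm2 (a *: u) ^+ 2 = a ^+ 2 * norm2 u ^+ 2.
Proof. by rewrite !sqr_norm2 dotZl dotZr; ring. Qed.

Lemma sqr_norm2B {R : realType} {m : nat} (u v : 'cV[R]_m) :
  norm2 (u - v) ^+ 2 = norm2 u ^+ 2 - 2 * dot u v + norm2 v ^+ 2.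
Proof. by rewrite -scaleN1r sqr_norm2D sqr_norm2Z dotZr; ring. Qed.

(** Parallelogram identity; its last term is the source of strong convexity. *)
Lemma sqr_norm2_mid {R : realType} {m : nat} (u v : 'cV[R]_m) :
  norm2 (2^-1 *: (u + v)) ^+ 2 =
  2^-1 * norm2 u ^+ 2 + 2^-1 * norm2 v ^+ 2 - 4^-1 * norm2 (u - v) ^+ 2.
Proof. by rewrite sqr_norm2Z sqr_norm2D sqr_norm2B; field. Qed.

Lemma dot_young {R : realType} {m : nat} (s : R) (u v : 'cV[R]_m) :
  0 < s -> 2 * dot u v <= s * norm2 u ^+ 2 + norm2 v ^+ 2 / s.
Proof.
move=> s0; have := sqr_ge0 (norm2 (s *: u - v)).
rewrite sqr_norm2B sqr_norm2Z dotZl => H.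
rewrite -(ler_pM2l s0).
have -> : s * (s * norm2 u ^+ 2 + norm2 v ^+ 2 / s) =
  s ^+ 2 * norm2 u ^+ 2 + norm2 v ^+ 2 by field; rewrite gt_eqF.
by lra.
Qed.

Lemma feasible_cone {R : realType} {k N : nat} (C : 'M[R]_(k, N)) (a b : R)
    (x y : 'cV[R]_N) :
  0 <= a -> 0 <= b -> feasible C x -> feasible C y ->
  feasible C (a *: x + b *: y).
Proof.
move=> a0 b0 Fx Fy i; rewrite mulmxDr -!scalemxAr !mxE.
have := Fx i; have := Fy i; rewrite !mxE => Hy Hx.
by nra.
Qed.

Lemma feasible0 {R : realType} {k N : nat} (C : 'M[R]_(k, N)) : feasible C 0.
Proof. by move=> i; rewrite mulmx0. Qed.

Lemma feasibleZ {R : realType} {k N : nat} (C : 'M[R]_(k, N)) (a : R)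
    (x : 'cV[R]_N) : 0 <= a -> feasible C x -> feasible C (a *: x).
Proof.
move=> a0 Fx; rewrite -[_ *: x]addr0 -(scale0r 0).
exact: feasible_cone (feasible0 C).
Qed.

(** * Optimality conditions at a fixed parameter *)

Lemma argmin_tikhonov_le {R : realType} {Nl N : nat} {K : 'M[R]_(Nl, N)}
    {r : 'cV[R]_Nl} {A : set 'cV[R]_N} {g : R} {x : 'cV[R]_N} :
  is_argmin A (tikhonov K r g) x -> forall y, A y ->
  norm2 (K *m x - r) ^+ 2 + g * norm2 x ^+ 2 <=
  norm2 (K *m y - r) ^+ 2 + g * norm2 y ^+ 2.
Proof. by move=> [_ xmin] y /xmin; rewrite /tikhonov; lra. Qed.

(* The objective is quadratic along the ray through [x], which stays in the
   feasible cone, so its derivative at [x] vanishes. *)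
Lemma argmin_stationary {R : realType} {Nl N k : nat} {K : 'M[R]_(Nl, N)}
    {r : 'cV[R]_Nl} {C : 'M[R]_(k, N)} {g : R} {x : 'cV[R]_N} :
  0 <= g -> is_argmin (feasible C) (tikhonov K r g) x ->
  dot (K *m x - r) (K *m x) + g * norm2 x ^+ 2 = 0.
Proof.
move=> g0 xmin; set a := LHS.
set b := norm2 (K *m x) ^+ 2 + g * norm2 x ^+ 2.
have b0 : 0 <= b by apply: addr_ge0; rewrite ?sqr_ge0 // mulr_ge0 ?sqr_ge0.
(* This is twice the change of the objective from [x] to [(1 + t) *: x]. *)
have quad t : -1 <= t -> 0 <= 2 * t * a + t ^+ 2 * b.
  move=> t1; have Ft : feasible C ((1 + t) *: x).
    by apply: feasibleZ; [lra | case: xmin].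
  have := argmin_tikhonov_le xmin _ Ft.
  rewrite -scalemxAr [(1 + t) *: (K *m x)]scalerDl scale1r addrAC.
  by rewrite (sqr_norm2D (K *m x - r)) !sqr_norm2Z dotZr /a /b; lra.
apply/eqP; apply: contraT => a_neq0.
have a2 : 0 < a ^+ 2 by rewrite exprn_even_gt0.
(* For [t = - a / c], [a <= c] gives [-1 <= t], and [b <= c] makes the quadratic
   [(a ^+ 2 / c ^+ 2) * (b - 2 * c)] negative. *)
have [c [c0 ac bc]] : exists c, [/\ 0 < c, a <= c & b <= c].
  exists (b + `|a| + 1).
  by have := normr_ge0 a; have := ler_norm a; split; lra.
clearbody a b.
have : 0 <= 2 * (- a / c) * a + (- a / c) ^+ 2 * b.
  by apply: quad; rewrite mulNr lerN2 ler_pdivrMr // mul1r.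
have -> : 2 * (- a / c) * a + (- a / c) ^+ 2 * b =
    (a ^+ 2 / c ^+ 2) * (b - 2 * c) by field; rewrite gt_eqF.
by rewrite pmulr_rge0; [lra | rewrite divr_gt0 // exprn_gt0].
Qed.

(** Compare [x] with the feasible midpoint of [x] and [y], and drop the curvature of the residual
    term. *)
Lemma argmin_strong {R : realType} {Nl N k : nat} {K : 'M[R]_(Nl, N)}
    {r : 'cV[R]_Nl} {C : 'M[R]_(k, N)} {g : R} {x : 'cV[R]_N} :
  is_argmin (feasible C) (tikhonov K r g) x ->
  forall y, feasible C y ->
  norm2 (K *m x - r) ^+ 2 + g * norm2 x ^+ 2 + 2^-1 * (g * norm2 (x - y) ^+ 2)
  <= norm2 (K *m y - r) ^+ 2 + g * norm2 y ^+ 2.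
Proof.
move=> xmin y Fy.
have Fm : feasible C (2^-1 *: (x + y)).
  by rewrite scalerDr; apply: feasible_cone; rewrite ?invr_ge0 //; case: xmin.
have := argmin_tikhonov_le xmin _ Fm.
have -> : K *m (2^-1 *: (x + y)) - r
    = 2^-1 *: ((K *m x - r) + (K *m y - r)).
  apply/colP => i; rewrite -scalemxAr mulmxDr !mxE; by field.
rewrite !sqr_norm2_mid.
have := sqr_ge0 (norm2 (K *m x - r - (K *m y - r))).
by lra.
Qed.

(** * Dependence of minimizers and residuals on the parameter *)

Lemma argmin_monotone {R : realType} {Nl N : nat} {K : 'M[R]_(Nl, N)}
    {r : 'cV[R]_Nl} {A : set 'cV[R]_N} {g h : R} {x y : 'cV[R]_N} :
  0 <= g -> g < h ->
  is_argmin A (tikhonov K r g) x -> is_argmin A (tikhonov K r h) y ->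
  norm2 y ^+ 2 <= norm2 x ^+ 2 /\
  norm2 (K *m x - r) ^+ 2 <= norm2 (K *m y - r) ^+ 2.
Proof.
move=> g0 gh xmin ymin.
have xy := argmin_tikhonov_le xmin _ ymin.1.
have yx := argmin_tikhonov_le ymin _ xmin.1.
(* In the sum of [xy] and [yx] the residuals cancel; the norm comparison put back into [xy] orders
   the residuals. *)
have Eyx : norm2 y ^+ 2 <= norm2 x ^+ 2 by nra.
by split=> //; nra.
Qed.

(* If the residuals agree, [y] is optimal for both parameters, and subtracting
   the two stationarity conditions forces [y = 0]. *)
Lemma argmin_residual_lt {R : realType} {Nl N k : nat} {K : 'M[R]_(Nl, N)}
    {r : 'cV[R]_Nl} {C : 'M[R]_(k, N)} {g h : R} {x y : 'cV[R]_N} :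
  0 <= g -> g < h ->
  is_argmin (feasible C) (tikhonov K r g) x ->
  is_argmin (feasible C) (tikhonov K r h) y -> y != 0 ->
  norm2 (K *m x - r) < norm2 (K *m y - r).
Proof.
move=> g0 gh xmin ymin y0.
have [Eyx Rxy] := argmin_monotone g0 gh xmin ymin.
have h0 := le_lt_trans g0 gh.
rewrite -ltr_sqr ?nnegrE ?norm2_ge0 //.
rewrite lt_neqAle Rxy andbT; apply: contraNneq y0 => Rxy_eq.
have yming : is_argmin (feasible C) (tikhonov K r g) y.
  split=> [|z Fz]; first exact: ymin.1.
  apply: le_trans (xmin.2 z Fz); rewrite /tikhonov Rxy_eq lerD2l.
  by apply: ler_wpM2l => //; apply: mulr_ge0; rewrite ?invr_ge0.
have sg := argmin_stationary g0 yming.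
have sh := argmin_stationary (ltW h0) ymin.
apply/eqP/sqr_norm2_eq0/eqP.
have /eqP : (h - g) * norm2 y ^+ 2 = 0 by lra.
by rewrite mulf_eq0 subr_eq0 gt_eqF.
Qed.

(** Strong convexity at [g] and optimality at [h] bound [2^-1 * g * norm2 (x - y) ^+ 2] by [h - g]
    times the drop of the squared norm, while that drop is at most [2 * dot (x - y) x]. *)
Lemma argmin_norm_decay {R : realType} {Nl N k : nat} {K : 'M[R]_(Nl, N)}
    {r : 'cV[R]_Nl} {C : 'M[R]_(k, N)} {g h : R} {x y : 'cV[R]_N} :
  0 < g -> g < h ->
  is_argmin (feasible C) (tikhonov K r g) x ->
  is_argmin (feasible C) (tikhonov K r h) y ->
  g * (norm2 x ^+ 2 - norm2 y ^+ 2) <= 8 * (h - g) * norm2 x ^+ 2.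
Proof.
move=> g0 gh xmin ymin.
have strong := argmin_strong xmin _ ymin.1.
have yx := argmin_tikhonov_le ymin _ xmin.1.
have hg : 0 < h - g by rewrite subr_gt0.
have s0 : 0 < g / (4 * (h - g)) by rewrite divr_gt0 // mulr_gt0.
(* The weight in Young's inequality is chosen so that the strong convexity
   bound absorbs the quadratic term into half of the left-hand side. *)
have young := dot_young (g / (4 * (h - g))) (x - y) x s0.
have Ey : norm2 y ^+ 2 =
    norm2 x ^+ 2 - 2 * dot (x - y) x + norm2 (x - y) ^+ 2.
  by rewrite -[in LHS](subKr x y) (sqr_norm2B x (x - y)) (dotC x).
have d0 := sqr_ge0 (norm2 (x - y)).
have sd : g / (4 * (h - g)) * norm2 (x - y) ^+ 2
    <= 2^-1 * (norm2 x ^+ 2 - norm2 y ^+ 2).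
  rewrite mulrAC ler_pdivrMr ?mulr_gt0 //; nra.
have Es : g * (norm2 x ^+ 2 / (g / (4 * (h - g)))) =
    4 * (h - g) * norm2 x ^+ 2 by field; rewrite !gt_eqF.
have : norm2 x ^+ 2 - norm2 y ^+ 2 <=
   2^-1 * (norm2 x ^+ 2 - norm2 y ^+ 2) + norm2 x ^+ 2 / (g / (4 * (h - g))).
  by lra.
by rewrite -(ler_pM2l g0) [in leRHS]mulrDr Es; lra.
Qed.

(** Optimality of [y] bounds the increase by [h * (norm2 x ^+ 2 - norm2 y ^+ 2)]. When [h <= 2 * g],
    the constant 8 of [argmin_norm_decay] doubles to 16. *)
Lemma argmin_residual_lipschitz {R : realType} {Nl N k : nat}
    {K : 'M[R]_(Nl, N)} {r : 'cV[R]_Nl} {C : 'M[R]_(k, N)} {g h : R}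
    {x0 x y : 'cV[R]_N} :
  0 <= g -> g < h ->
  is_argmin (feasible C) (tikhonov K r 0) x0 ->
  is_argmin (feasible C) (tikhonov K r g) x ->
  is_argmin (feasible C) (tikhonov K r h) y ->
  norm2 (K *m y - r) ^+ 2 - norm2 (K *m x - r) ^+ 2
  <= 16 * norm2 x0 ^+ 2 * (h - g).
Proof.
move=> g0 gh x0min xmin ymin.
have E0 := sqr_ge0 (norm2 x0); have Ey := sqr_ge0 (norm2 y).
(* [h / g] is not bounded when [g] is small; then compare with [x0] directly. *)
have [h2g|hg] := ltP (2 * g) h.
  have y0 := argmin_tikhonov_le ymin _ x0min.1.
  have x0x := argmin_tikhonov_le x0min _ xmin.1.
  by nra.
have gp : 0 < g by lra.
have yx := argmin_tikhonov_le ymin _ xmin.1.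
have [Exx0 _] := argmin_monotone (lexx 0) gp x0min xmin.
have [Eyx _] := argmin_monotone g0 gh xmin ymin.
have decay := argmin_norm_decay gp gh xmin ymin.
have : h * (norm2 x ^+ 2 - norm2 y ^+ 2) <=
  2 * g * (norm2 x ^+ 2 - norm2 y ^+ 2) by rewrite ler_wpM2r ?subr_ge0.
have : (h - g) * norm2 x ^+ 2 <= (h - g) * norm2 x0 ^+ 2.
  by rewrite ler_wpM2l // subr_ge0 ltW.
by lra.
Qed.

(** By stationarity [dot x (K^T *m r)] equals [norm2 (K *m x) ^+ 2 + g * norm2 x ^+ 2]; Young's
    inequality with weight [g] then bounds this cross term by [norm2 (K^T *m r) ^+ 2 / g]. *)
Lemma argmin_residual_lower {R : realType} {Nl N k : nat}
    {K : 'M[R]_(Nl, N)} {r : 'cV[R]_Nl} {C : 'M[R]_(k, N)} {g : R}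
    {x : 'cV[R]_N} :
  0 < g -> is_argmin (feasible C) (tikhonov K r g) x ->
  norm2 r ^+ 2 - 2 * (norm2 (K^T *m r) ^+ 2 / g) <= norm2 (K *m x - r) ^+ 2.
Proof.
move=> g0 xmin; have := argmin_stationary (ltW g0) xmin.
rewrite -scaleN1r dotDl dotZl -sqr_norm2 scaleN1r sqr_norm2B.
rewrite (dotC r) (dot_mulmxl K x r).
have := dot_young g x (K^T *m r) g0.
have := sqr_ge0 (norm2 (K *m x)).
by lra.
Qed.

(** * Intermediate values on the half-line *)

Lemma monotone_lipschitz_ivt {R : realType} (f : R -> R) (L b t : R) :
  (forall g h, 0 <= g -> g < h -> f g <= f h) ->
  (forall g h, 0 <= g -> g < h -> f h - f g <= L * (h - g)) ->
  0 <= b -> f 0 <= t -> t < f b -> exists2 c, 0 <= c & f c = t.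
Proof.
move=> fmono flip b0 f0t tfb.
(* [L] may be zero or negative; a positive Lipschitz constant can be divided by. *)
have L1 : 0 < `|L| + 1 by have := normr_ge0 L; lra.
have LL : L <= `|L| + 1 by have := ler_norm L; lra.
pose S : set R := fun g => 0 <= g /\ f g <= t.
have S0 : S 0 by [].
have Sb : ubound S b.
  move=> g [g0 fgt]; rewrite leNgt; apply/negP => bg.
  by have := fmono _ _ b0 bg; lra.
have hS : has_sup S by split; [exists 0 | exists b].
have c0 : 0 <= sup S by apply: ub_le_sup => //; exists b.
exists (sup S) => //; apply/eqP; rewrite eq_le; apply/andP; split.
  rewrite leNgt; apply/negP => tfc.
  (* A member of [S] this close to [sup S] would have a value above [t]. *)
  have e0 : 0 < (f (sup S) - t) / (`|L| + 1) by rewrite divr_gt0 ?subr_gt0.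
  have [g [g0 fgt] cg] := sup_adherent e0 hS.
  have gc : g < sup S.
    rewrite lt_neqAle ub_le_sup ?andbT //; last by exists b.
    by apply: contraTneq tfc => <-; rewrite -leNgt.
  have := flip _ _ g0 gc.
  have : sup S - g < (f (sup S) - t) / (`|L| + 1) by lra.
  rewrite ltr_pdivlMr // => H.
  by nra.
rewrite leNgt; apply/negP => fct.
(* Over a length [e] the function rises by at most [t - f (sup S)], so [sup S + e] would still lie
   in [S]. *)
set e := (t - f (sup S)) / (`|L| + 1).
have e0 : 0 < e by rewrite divr_gt0 ?subr_gt0.
have ch : sup S < sup S + e by rewrite ltrDl.
have Eh : e * (`|L| + 1) = t - f (sup S) by rewrite divfK // gt_eqF.
have : sup S + e <= sup S.
  apply: ub_le_sup; first by exists b.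
  split; first by lra.
  have := flip _ _ c0 ch; nra.
by lra.
Qed.

Theorem theorem3p6 (R : realType) (Nl N k : nat)
    (K : 'M[R]_(Nl, N)) (r : 'cV[R]_Nl) (C : 'M[R]_(k, N))
    (hkN : (k <= N)%N) (hC : \rank C = k)
    (n : R -> 'cV[R]_N)
    (hn : forall gamma : R, 0 <= gamma ->
       is_argmin (feasible C) (tikhonov K r gamma) (n gamma))
    (hres : forall gamma : R, 0 <= gamma ->
       norm2 (K *m n gamma - r) < norm2 r)
    (ninf : 'cV[R]_N)
    (hninf : is_argmin (feasible C)
       (fun x : 'cV[R]_N => 2^-1 * norm2 x ^+ 2) ninf) :
  let r0 := norm2 (K *m n 0 - r) in
  let rinf := norm2 (K *m ninf - r) in
  (forall tau : R, r0 <= tau -> tau < rinf ->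
     exists! gamma : R, 0 <= gamma /\ norm2 (K *m n gamma - r) = tau) /\
  (forall gamma1 gamma2 : R, 0 <= gamma1 -> gamma1 < gamma2 ->
     norm2 (K *m n gamma1 - r) < norm2 (K *m n gamma2 - r)).
Proof.
move=> r0 rinf.
have norm2_res0 : norm2 (K *m 0 - r) ^+ 2 = norm2 r ^+ 2.
  by rewrite mulmx0 sub0r -scaleN1r sqr_norm2Z; ring.
have strict g h : 0 <= g -> g < h ->
    norm2 (K *m n g - r) < norm2 (K *m n h - r).
  move=> g0 gh; have h0 := ltW (le_lt_trans g0 gh).
  apply: (argmin_residual_lt g0 gh (hn _ g0) (hn _ h0)).
  (* [n h] is nonzero because the zero vector has residual [norm2 r]. *)
  apply: contraTneq (hres _ h0) => ->.
  by rewrite -ltr_sqr ?nnegrE ?norm2_ge0 // norm2_res0 ltxx.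
split=> // tau r0tau taurinf.
have tau0 : 0 <= tau := le_trans (norm2_ge0 _) r0tau.
have ninf0 : ninf = 0.
  apply: sqr_norm2_eq0; have := hninf.2 _ (feasible0 C).
  rewrite -[X in _ <= _ * norm2 X ^+ 2](scale0r 0) sqr_norm2Z.
  by have := sqr_ge0 (norm2 ninf); lra.
have tau_r : 0 < norm2 r ^+ 2 - tau ^+ 2.
  by rewrite subr_gt0 -norm2_res0 -ninf0 ltr_sqr ?nnegrE ?norm2_ge0.
set M := norm2 (K^T *m r) ^+ 2.
have M0 : 0 <= M by exact: sqr_ge0.
(* Chosen so that [2 * (M / b)] is below [norm2 r ^+ 2 - tau ^+ 2]; the lower bound then puts the
   residual at [b] above [tau]. *)
set b := 2 * (M + 1) / (norm2 r ^+ 2 - tau ^+ 2).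
have b0 : 0 < b by rewrite divr_gt0 // mulr_gt0 // ltr_pwDr.
have [c c0 fc] : exists2 c, 0 <= c & norm2 (K *m n c - r) ^+ 2 = tau ^+ 2.
  apply: (@monotone_lipschitz_ivt _ (fun g => norm2 (K *m n g - r) ^+ 2)
            (16 * norm2 (n 0) ^+ 2) b) => [g h g0 gh|g h g0 gh|||].
  - by rewrite ler_sqr ?nnegrE ?norm2_ge0 // ltW // strict.
  - have h0 := ltW (le_lt_trans g0 gh).
    exact: argmin_residual_lipschitz g0 gh (hn _ (lexx 0)) (hn _ g0) (hn _ h0).
  - exact: ltW.
  - by rewrite ler_sqr ?nnegrE ?norm2_ge0.
  - apply: lt_le_trans (argmin_residual_lower b0 (hn _ (ltW b0))).
    have : 2 * (M / b) < norm2 r ^+ 2 - tau ^+ 2.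
      rewrite mulrA ltr_pdivrMr //.
      have -> : (norm2 r ^+ 2 - tau ^+ 2) * b = 2 * (M + 1).
        by rewrite mulrC divfK // gt_eqF.
      by lra.
    by rewrite -/M; lra.
have {}fc : norm2 (K *m n c - r) = tau.
  by apply/eqP; rewrite -(eqrXn2 (n := 2)) ?norm2_ge0 // fc.
exists c; split=> // d [d0 fd].
have [cd|dc|//] := ltgtP c d.
- by have := strict _ _ c0 cd; rewrite fc fd ltxx.
- by have := strict _ _ d0 dc; rewrite fc fd ltxx.
Qed.
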